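(* Let $\mathcal{H}$ be a finite-dimensional Hilbert space with norm $\|\cdot\|$, let $x_0\in\mathcal{H}$, let $A:\mathcal{H}\to\mathbb{R}^m$ be linear and let $f:\mathcal{H}\to\mathbb{R}$ be convex. For $\epsilon\ge 0$ consider the program $$\min_{x\in\mathcal{H}} f(x)\quad\text{subject to}\quad\|Ax-b\|_2\le\epsilon, \qquad (\ast)$$ where $b=Ax_0+n$ with $n\in\mathbb{R}^m$, $\|n\|_2\le\epsilon$. If there exists a $\theta>0$ such that $$\mathcal{D}^{\wedge\theta}(f,x_0)\cap\ker A=\{0\},$$ then there exists a constant $\kappa>0$, depending only on $\theta$ and on the smallest non-zero singular value $\sigma_{\min}(A)$ of $A$, such that any solution $\hat{x}$ of $(\ast)$ obeys $$\|\hat{x}-x_0\|\le\kappa\,\epsilon.$$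
   Context: $\|\cdot\|$ is the norm induced by the inner product $\langle\cdot,\cdot\rangle$ of $\mathcal{H}$; $\mathbb{R}^m$ carries the Euclidean norm. The descent cone of $f:\mathcal{H}\to\mathbb{R}$ at $x_0$ is $\mathcal{D}(f,x_0)=\{\eta\in\mathcal{H} : \exists \tau>0,\ f(x_0+\tau\eta)\le f(x_0)\}$. For a convex cone $C\subseteq\mathcal{H}$ (a convex set with $\tau C=C$ for all $\tau>0$) and $\theta\in[0,\pi]$, the $\theta$-expansion of $C$ is $C^{\wedge\theta}=\{0\}\cup\{x\in\mathcal{H} : \exists y\in C\setminus\{0\},\ \langle x,y\rangle\ge\cos(\theta)\|x\|\|y\|\}$. One writes $\mathcal{D}^{\wedge\theta}(f,x_0)=(\mathcal{D}(f,x_0))^{\wedge\theta}$, and ''$\theta>0$'' means $\theta\in(0,\pi]$. *)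

(* Defs.v *)
From HB Require Import structures.
From mathcomp Require Import all_boot all_order all_algebra.
From mathcomp Require Import all_classical all_reals all_analysis.

Set Implicit Arguments.
Unset Strict Implicit.
Unset Printing Implicit Defensive.
Import Order.TTheory GRing.Theory Num.Theory.
Local Open Scope classical_set_scope.
Local Open Scope ring_scope.

(* A finite-dimensional real Hilbert space is a vectType V over R together with
   an inner product, i.e. a positive definite symmetric bilinear form
   d : {dot V for idfun}. *)

Definition euclid (R : realType) (m : nat) (u v : 'cV[R]_m) : R :=
  \sum_(i < m) u i 0 * v i 0.

Section EuclidDot.
Variables (R : realType) (m : nat).

Fact euclid_bilinear :
  bilinear_for *%R (idfun \; *%R : R -> R -> R) (@euclid R m).
Proof.
split=> u a x y /=; rewrite /euclid mulr_sumr -big_split /=; apply: eq_bigr.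
  by move=> i _; rewrite !mxE mulrDl mulrA.
by move=> i _; rewrite !mxE mulrDr mulrCA.
Qed.

HB.instance Definition _ := bilinear_isBilinear.Build
  R _ _ _ _ _ (@euclid R m) euclid_bilinear.

Fact euclid_sym (u v : 'cV[R]_m) :
  euclid u v = (-1) ^+ false * idfun (euclid v u).
Proof. by rewrite mul1r; apply: eq_bigr => i _; rewrite mulrC. Qed.

HB.instance Definition _ := isHermitianSesquilinear.Build
  R _ false idfun (@euclid R m) euclid_sym.

Fact euclid_gt0 (u : 'cV[R]_m) : u != 0 -> 0 < euclid u u.
Proof.
move=> u0; rewrite lt_def sumr_ge0 ?andbT; last by move=> i _; exact: sqr_ge0.
apply: contra u0; rewrite psumr_eq0; last by move=> i _; exact: sqr_ge0.
move=> /allP u0; apply/eqP/colP => i; rewrite mxE.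
by have := u0 i (mem_index_enum _); rewrite mulf_eq0 orbb => /eqP.
Qed.

HB.instance Definition _ := isDotProduct.Build R _ (@euclid R m) euclid_gt0.

End EuclidDot.

Definition euclidean (R : realType) (m : nat) : {dot 'cV[R]_m for idfun} :=
  @euclid R m.

Definition dotnorm (R : realType) (V : lmodType R) (d : {dot V for idfun})
  (x : V) : R := Num.sqrt (d x x).

Section Adjoint.
Variables (R : realType) (V W : vectType R).
Variables (dV : {dot V for idfun}) (dW : {dot W for idfun}).

Definition adjoint (A : 'Hom(V, W)) : 'Hom(W, V) :=
  xget 0 [set B : 'Hom(W, V) | forall x y, dW (A x) y = dV x (B y)].

Lemma adjointP (A : 'Hom(V, W)) x y : dW (A x) y = dV x (adjoint A y).
Proof.
suff [B BP] : exists B : 'Hom(W, V), forall x y, dW (A x) y = dV x (B y).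
  by rewrite /adjoint; case: xgetP => [C _ CP|/(_ B)//]; exact: CP.
pose e := vbasis {:V}.
pose T (v : V) : 'rV[R]_(\dim {:V}) := \row_i dV e`_i v.
pose S (w : W) : 'rV[R]_(\dim {:V}) := \row_i dW (A e`_i) w.
have Tlin : linear T by move=> a u v; apply/rowP => i; rewrite !mxE linearPr.
have Slin : linear S by move=> a u v; apply/rowP => i; rewrite !mxE linearPr.
pose Tl : {linear V -> _} := HB.pack T (GRing.isLinear.Build _ _ _ _ T Tlin).
pose Sl : {linear W -> _} := HB.pack S (GRing.isLinear.Build _ _ _ _ S Slin).
have decomp (v : V) : v = \sum_i coord e i v *: e`_i.
  exact: coord_vbasis (memvf v).
have kerT : lker (linfun Tl) = 0%VS.
  apply/eqP; rewrite -subv0; apply/subvP => v.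
  rewrite memv_ker lfunE /= memv0 => /eqP /rowP Tv0.
  apply/negPn/negP => /(@neq0_dnorm_gt0 _ _ _ dV).
  rewrite {1}(decomp v) linear_sumlz big1 ?ltxx// => i _.
  by have := Tv0 i; rewrite linearZl_LR !mxE /= => ->; rewrite mulr0.
have imT : limg (linfun Tl) = fullv.
  apply/eqP; rewrite eqEdim subvf limg_dim_eq ?kerT ?capv0//.
  by rewrite andTb [X in (X <= _)%N]dimvf dim_matrix; apply/eq_leq/mul1n.
exists ((linfun Tl)^-1 \o linfun Sl)%VF => {}x {}y.
have /rowP TB : T (((linfun Tl)^-1 \o linfun Sl)%VF y) = S y.
  have -> w : T w = linfun Tl w by rewrite lfunE.
  by rewrite comp_lfunE limg_lfunVK ?imT ?memvf// lfunE.
rewrite (decomp x) linear_sum !linear_sumlz; apply: eq_bigr => i _.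
have := TB i; rewrite !mxE => TBi.
by rewrite linearZ !linearZl_LR /=; congr (_ * _); rewrite -TBi.
Qed.

End Adjoint.

Definition singular_value (R : realType) (V : vectType R)
    (d : {dot V for idfun}) (m : nat) (A : 'Hom(V, 'cV[R]_m)) (s : R) : Prop :=
  0 <= s /\ passmx.leigenvalue (adjoint d (euclidean R m) A \o A)%VF (s ^+ 2).

(* The set is finite, so for A != 0 this infimum is a minimum. The zero map has
   no non-zero singular value; there the infimum of the empty set is 0. *)
Definition sigma_min (R : realType) (V : vectType R)
    (d : {dot V for idfun}) (m : nat) (A : 'Hom(V, 'cV[R]_m)) : R :=
  inf [set s | singular_value d A s /\ s != 0].

Definition descent_cone (R : realType) (V : lmodType R) (f : V -> R) (x0 : V) :
    set V :=
  [set eta | exists tau : R, 0 < tau /\ f (x0 + tau *: eta) <= f x0].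

Definition cone_expansion (R : realType) (V : lmodType R)
    (d : {dot V for idfun}) (theta : R) (C : set V) : set V :=
  [set 0] `|` [set x | exists y, [/\ C y, y != 0 &
                         cos theta * dotnorm d x * dotnorm d y <= d x y]].

Definition feasible (R : realType) (V : vectType R) (m : nat)
    (A : 'Hom(V, 'cV[R]_m)) (b : 'cV[R]_m) (eps : R) : set V :=
  [set x | dotnorm (euclidean R m) (A x - b) <= eps].

Definition is_minimizer (R : realType) (V : Type) (f : V -> R) (D : set V)
    (x : V) : Prop :=
  D x /\ forall z, D z -> f x <= f z.

(* Main.v *)
Require Import Defs.
From HB Require Import structures.
From mathcomp Require Import all_boot all_order all_algebra.
From mathcomp Require Import all_classical all_reals all_analysis.
From mathcomp Require Import ring lra.

Set Implicit Arguments.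
Unset Strict Implicit.
Unset Printing Implicit Defensive.
Import Order.TTheory GRing.Theory Num.Theory.
Local Open Scope classical_set_scope.
Local Open Scope ring_scope.

(** Put h = xhat - x0.  Since x0 is feasible, f xhat <= f x0, so h is a descent
direction, and the triangle inequality gives |A h| <= 2 eps.  Split h = k + r
with k in ker A and r orthogonal to ker A.

- The vector k satisfies <k, h> = |k|^2, and for k != 0 it avoids the expanded
  cone, so |k| < cos theta * |h|.  Together with |h| <= |k| + |r| this makes r a
  definite fraction of h: (1 - cos theta) |h| <= 2 |r|
  (dotnorm_le_orthogonal_part).  The factor 2 also covers the case k = 0, where
  r = h and cos theta may be negative, so that no distinction between acute and
  obtuse theta is needed.
- On the orthogonal complement of ker A, A stretches at least by its smallest
  non-zero singular value: sigma_min |r| <= |A r| = |A h| <= 2 eps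
  (sigma_min_bound).

Hence kappa = 4 / ((1 - cos theta) sigma_min) works.  If A = 0 there is no
non-zero singular value, but then r = 0, so h = 0 and any kappa > 0 will do.

The second point is the variational characterization of the least positive
eigenvalue of T = A^* A (least_positive_eigenvalue).  It is proved without
compactness and without diagonalization.  Let l be the supremum of the constants
c with c |x|^2 <= <T x, x> on the range of T.  If l were not an eigenvalue,
T - l would be invertible and positive semidefinite on that range, and the
Cauchy-Schwarz inequality for the form <(T - l) x, y> would turn the
boundedness of the inverse into a strictly better constant than l
(coercive_of_section).  The same lemma, applied to T itself, shows l > 0.  All
of this takes place on the range of T, which is the orthogonal complement of
ker T = ker A (limg_lker_split). *)

(** * Inner products on finite-dimensional spaces *)

Section DotProduct.
Variables (R : realType) (V : vectType R) (d : {dot V for idfun}).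
Implicit Types (x y u v : V) (S B : 'End(V)) (U W : {vspace V}).

Lemma dotC x y : d x y = d y x.
Proof. by rewrite hermC /= expr0 mul1r. Qed.

Lemma dotDl x y u : d (x + y) u = d x u + d y u.
Proof. exact: linearDl. Qed.

Lemma dotDr x y u : d u (x + y) = d u x + d u y.
Proof. exact: linearDr. Qed.

Lemma dotBl x y u : d (x - y) u = d x u - d y u.
Proof. exact: linearBl. Qed.

Lemma dotBr x y u : d u (x - y) = d u x - d u y.
Proof. exact: linearBr. Qed.

Lemma dotZl a x y : d (a *: x) y = a * d x y.
Proof. exact: linearZl_LR. Qed.

Lemma dotZr a x y : d x (a *: y) = a * d x y.
Proof. exact: linearZr_LR. Qed.

Lemma dot_gt0 x : x != 0 -> 0 < d x x.
Proof. exact: neq0_dnorm_gt0. Qed.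

Lemma dot_ge0 x : 0 <= d x x.
Proof.
by have [->|x0] := eqVneq x 0; [rewrite linear0r | exact/ltW/dot_gt0].
Qed.

Lemma dot_eq0 x : d x x = 0 -> x = 0.
Proof.
by move=> xx0; apply/eqP; apply: contra_eqT xx0 => /dot_gt0; rewrite lt0r => /andP[].
Qed.

Definition symmetric_op S := forall x y, d (S x) y = d x (S y).

(** Positivity is asked only on W, because the operator T - l studied below is
positive on the range of T but equals - l on its kernel. *)
Lemma psd_CauchySchwarz S W : symmetric_op S ->
  {in W, forall x, 0 <= d (S x) x} ->
  {in W &, forall x y, d (S x) y ^+ 2 <= d (S x) x * d (S y) y}.
Proof.
move=> Ssym Spos x y xW yW.
set a := d (S x) x; set b := d (S x) y; set c := d (S y) y.
have quad s t : 0 <= s ^+ 2 * a + s * t * b *+ 2 + t ^+ 2 * c.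
  have -> : s ^+ 2 * a + s * t * b *+ 2 + t ^+ 2 * c =
      d (S (s *: x + t *: y)) (s *: x + t *: y).
    have -> : S (s *: x + t *: y) = s *: S x + t *: S y by rewrite linearD !linearZ.
    rewrite !dotDl !dotDr !dotZl !dotZr [d (S y) x]Ssym.
    by rewrite [d y (S x)]dotC -/a -/b -/c; ring.
  by apply: Spos; rewrite memvD// memvZ.
have a0 : 0 <= a by exact: Spos.
have c0 : 0 <= c by exact: Spos.
(* For a = 0 the quadratic form is linear in s, which forces b = 0; for a > 0
   its value at (- b, a) is a (a c - b ^ 2). *)
have [a_eq0|a_neq0] := eqVneq a 0.
  by have := quad (- (c + 1)) b; rewrite a_eq0; nra.
have : 0 < a by rewrite lt_def a_neq0.
have := quad (- b) a; nra.
Qed.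

Lemma dot_CauchySchwarz x y : d x y ^+ 2 <= d x x * d y y.
Proof.
have := @psd_CauchySchwarz \1%VF fullv.
move=> /(_ _ _ x y (memvf _) (memvf _)); rewrite !id_lfunE; apply.
- by move=> u v; rewrite !id_lfunE.
- by move=> u _; rewrite id_lfunE dot_ge0.
Qed.

Lemma dotnorm_ge0 x : 0 <= dotnorm d x.
Proof. exact: sqrtr_ge0. Qed.

Lemma sqr_dotnorm x : dotnorm d x ^+ 2 = d x x.
Proof. by rewrite sqr_sqrtr ?dot_ge0. Qed.

Lemma dotnorm0 : dotnorm d 0 = 0.
Proof. by rewrite /dotnorm linear0r sqrtr0. Qed.

Lemma dotnormD x y : dotnorm d (x + y) <= dotnorm d x + dotnorm d y.
Proof.
have := dot_CauchySchwarz x y; rewrite -!sqr_dotnorm -exprMn => CS.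
have xyP : d x y <= dotnorm d x * dotnorm d y.
  apply: le_trans (ler_norm _) _.
  by rewrite -ler_sqr ?nnegrE ?mulr_ge0 ?dotnorm_ge0// real_normK ?num_real.
rewrite -ler_sqr ?nnegrE ?addr_ge0 ?dotnorm_ge0//.
rewrite sqr_dotnorm dotDl !dotDr [d y x]dotC sqrrD !sqr_dotnorm.
lra.
Qed.

(** Riesz representation of the coordinate functionals: the adjoint of the
coordinate map V -> R^n sends the standard basis to the representing vectors. *)
Lemma coord_riesz : exists v : 'I_(\dim {:V}) -> V,
  forall i x, coord (vbasis {:V}) i x = d x (v i).
Proof.
pose G x : 'cV[R]_(\dim {:V}) := \col_i coord (vbasis {:V}) i x.
have Glin : linear G by move=> a x y; apply/colP => i; rewrite !mxE linearP.
pose Gl : {linear V -> _} := HB.pack G (GRing.isLinear.Build _ _ _ _ G Glin).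
exists (fun i => adjoint d (euclidean R _) (linfun Gl) (delta_mx i 0)) => i x.
rewrite -adjointP lfunE /= /euclidean /= /euclid (bigD1 i)//= !mxE !eqxx mulr1.
by rewrite big1 ?addr0// => j /negPf ji; rewrite !mxE ji mulr0.
Qed.

(** Expanding the second x in the basis writes <x, B x> as a sum of products
<x, v_i> <x, B e_i>, each at most half the sum of two squares that are
controlled by Cauchy-Schwarz. *)
Lemma quadratic_bounded B :
  exists2 C : R, 0 < C & forall x, d x (B x) <= C * d x x.
Proof.
have [v vP] := coord_riesz; pose e := vbasis {:V}.
pose C := \sum_i (d (v i) (v i) + d (B e`_i) (B e`_i)).
have C0 : 0 <= C by apply: sumr_ge0 => i _; rewrite addr_ge0 ?dot_ge0.
exists (C + 1) => [|x]; first by rewrite ltr_wpDl.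
rewrite mulrDl mul1r -[leLHS]addr0 lerD ?dot_ge0//.
rewrite {2}(coord_vbasis (memvf x)) linear_sum linear_sumr mulr_suml /=.
apply: ler_sum => i _; rewrite linearZ dotZr vP -/e.
have := dot_CauchySchwarz x (v i); have := dot_CauchySchwarz x (B e`_i).
have := sqr_ge0 (d x (v i) - d x (B e`_i)).
have := sqr_ge0 (d x (v i)); have := sqr_ge0 (d x (B e`_i)).
rewrite sqrrB; lra.
Qed.

(** * Spectral gap of a positive operator *)

(** Lower bound from a right inverse: Cauchy-Schwarz for the form <S x, y>,
applied to B x and x, gives |x|^4 <= <x, B x> <S x, x> <= C |x|^2 <S x, x>. *)
Lemma coercive_of_section S B U W : symmetric_op S ->
    {in W, forall x, 0 <= d (S x) x} -> (U <= W)%VS ->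
    {in U, forall x, B x \in W} -> {in U, forall x, S (B x) = x} ->
  exists2 c : R, 0 < c & {in U, forall x, c * d x x <= d (S x) x}.
Proof.
move=> Ssym Spos UW BW SB; have [C C0 CP] := quadratic_bounded B.
exists C^-1 => [|x xU]; first by rewrite invr_gt0.
have [->|x0] := eqVneq x 0; first by rewrite !linear0r ?mulr0.
have xx : 0 < d x x by exact: dot_gt0.
have xW := subvP UW _ xU.
have := psd_CauchySchwarz Ssym Spos (BW _ xU) xW; rewrite (SB _ xU) => CS.
rewrite mulrC ler_pdivrMr// -(ler_pM2l xx) -expr2.
apply: (le_trans CS); have := Spos _ xW; have := CP x; nra.
Qed.

Section PositiveOperator.
Variables (T : 'End(V)).
Hypotheses (Tsym : symmetric_op T) (Tpos : forall x, 0 <= d (T x) x).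

Lemma orthogonal_limg_lker x y : x \in limg T -> y \in lker T -> d x y = 0.
Proof.
by move=> /memv_imgP[z _ ->] /[!memv_ker] /eqP Ty; rewrite Tsym Ty linear0r.
Qed.

(** The range of T meets its kernel trivially, so T is injective on its own range
and maps it onto itself; any preimage r of T x within the range then differs
from x by an element of the kernel. *)
Lemma limg_lker_split x : exists2 r, r \in limg T & x - r \in lker T.
Proof.
have disj : (limg T :&: lker T = 0)%VS.
  apply/eqP; rewrite -subv0; apply/subvP => y; rewrite memv_cap memv0.
  by case/andP => y1 y2; apply/eqP/dot_eq0; exact: orthogonal_limg_lker.
have img2 : (T @: limg T)%VS = limg T.
  by apply/eqP; rewrite eqEdim limgS ?subvf //= (limg_dim_eq disj).
have : T x \in (T @: limg T)%VS by rewrite img2 memv_img ?memvf.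
by case/memv_imgP => r rT Txr; exists r; rewrite // memv_ker linearB /= Txr subrr.
Qed.

Lemma eigenvector_limg (l : R) v : l != 0 -> T v = l *: v -> v \in limg T.
Proof.
move=> l0 Tv; rewrite -[v]scale1r -(mulVf l0) -scalerA -Tv.
by rewrite memvZ// memv_img ?memvf.
Qed.

Lemma leigenvalueP (l : R) :
  reflect (exists2 v, v != 0 & T v = l *: v) (passmx.leigenvalue T l).
Proof.
have kerP v : (v \in passmx.leigenspace T l) = (T v == l *: v).
  by rewrite memv_ker !lfun_simp /= subr_eq0.
apply: (iffP idP) => [|[v v0 /eqP]].
  move=> /eqP l0; pose v := vpick (passmx.leigenspace T l).
  exists v; first by rewrite vpick0; apply/eqP.
  by apply/eqP; rewrite -kerP memv_pick.
rewrite -kerP => vl; apply: contraNneq v0 => l0.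
by rewrite -memv0 -l0.
Qed.

(** The eigenvalue l is the infimum of the Rayleigh quotient on the range of T,
here written as the supremum of the set E of its lower bounds. *)
Lemma least_positive_eigenvalue : limg T != 0%VS ->
  exists l : R, [/\ 0 < l, passmx.leigenvalue T l &
                    {in limg T, forall x, l * d x x <= d (T x) x}].
Proof.
move=> T0.
pose E : set R := [set c | {in limg T, forall x, c * d x x <= d (T x) x}].
have [c0 c0_gt0 c0E] : exists2 c : R, 0 < c & E c.
  apply: (@coercive_of_section T T^-1%VF (limg T) fullv) => //.
  - exact: subvf.
  - by move=> x _; exact: memvf.
  - by move=> x xT; rewrite limg_lfunVK.
have Eub x : x \in limg T -> x != 0 -> ubound E (d (T x) x / d x x).
  move=> xT x0 c cE; rewrite ler_pdivlMr; first exact: cE.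
  exact: dot_gt0.
have supE : has_sup E.
  split; first by exists c0.
  pose u := vpick (limg T); exists (d (T u) u / d u u).
  by apply: Eub; rewrite ?memv_pick ?vpick0.
pose l := sup E.
have l_gt0 : 0 < l by rewrite (lt_le_trans c0_gt0)// sup_upper_bound.
have lE : E l.
  move=> x xT; have [->|x0] := eqVneq x 0; first by rewrite !linear0r ?mulr0.
  rewrite -ler_pdivlMr; last exact: dot_gt0.
  by apply: ge_sup; [case: supE | exact: Eub].
exists l; split; [exact: l_gt0 | | exact: lE].
case: (boolP (passmx.leigenvalue T l)) => // lN; exfalso.
(* T - l is then invertible, and its inverse preserves the range of T because
   y = l^-1 (T y - x) whenever T y - l y = x. *)
pose S : 'End(V) := (T - l *: \1)%VF.
have SE x : S x = T x - l *: x by rewrite !lfun_simp.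
have kerS : lker S == 0%VS by rewrite -[_ == _]negbK; exact: lN.
have [c c_gt0 cP] : exists2 c : R, 0 < c &
    {in limg T, forall x, c * d x x <= d (S x) x}.
  apply: (@coercive_of_section S S^-1%VF _ (limg T)) => //.
  - by move=> x y; rewrite !SE dotBl dotBr dotZl dotZr Tsym.
  - move=> x xT; rewrite SE dotBl dotZl subr_ge0; exact: lE.
  - move=> x xT; have := lker0_lfunVK kerS x; rewrite SE.
    set y := (S^-1)%VF x => yx.
    rewrite -[y]scale1r -(mulVf (lt0r_neq0 l_gt0)) -scalerA.
    have -> : l *: y = T y - x by rewrite -[in RHS]yx subKr.
    by rewrite memvZ// memvB// memv_img ?memvf.
  - by move=> x _; exact: lker0_lfunVK.
suff /(sup_upper_bound supE) : E (l + c) by rewrite -/l; lra.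
move=> x xT; have := cP x xT.
by rewrite SE dotBl dotZl mulrDl; lra.
Qed.

End PositiveOperator.
End DotProduct.

(** * The smallest non-zero singular value *)

Section SmallestSingularValue.
Variables (R : realType) (V : vectType R) (d : {dot V for idfun}) (m : nat).
Variable A : 'Hom(V, 'cV[R]_m).
Let T := (adjoint d (euclidean R m) A \o A)%VF.

Lemma dot_gram x y : d (T x) y = euclidean R m (A x) (A y).
Proof. by rewrite comp_lfunE dotC -adjointP dotC. Qed.

Lemma gram_symmetric : symmetric_op d T.
Proof. by move=> x y; rewrite dot_gram [RHS]dotC dot_gram dotC. Qed.

Lemma gram_ge0 x : 0 <= d (T x) x.
Proof. by rewrite dot_gram dot_ge0. Qed.

Lemma lker_gram : lker T = lker A.
Proof.
apply/vspaceP => x; rewrite !memv_ker; apply/eqP/eqP => [Tx|Ax].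
  by apply: (dot_eq0 (d := euclidean R m)); rewrite -dot_gram Tx linear0l.
by rewrite comp_lfunE Ax linear0.
Qed.

(** The square root s of the least positive eigenvalue of A^* A is a singular value,
and any eigenvector for a positive eigenvalue lies in the range of A^* A, so that
no non-zero singular value is smaller: sigma_min A = s. *)
Lemma sigma_min_bound : limg T != 0%VS ->
  0 < sigma_min d A /\
  {in limg T, forall x,
    sigma_min d A * dotnorm d x <= dotnorm (euclidean R m) (A x)}.
Proof.
move=> /(least_positive_eigenvalue gram_symmetric gram_ge0)[l [l0 lT lP]].
pose s := Num.sqrt l; have s0 : 0 < s by rewrite sqrtr_gt0.
have sE : s ^+ 2 = l by rewrite sqr_sqrtr ?ltW.
pose E : set R := [set s | singular_value d A s /\ s != 0].
have Es : E s by split; [split; [exact: ltW | rewrite sE] | rewrite gt_eqF].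
have Elb : lbound E s.
  move=> t [[t0 /leigenvalueP[v v0 Tv]] tN].
  have tt : t ^+ 2 != 0 by rewrite sqrf_eq0.
  have := lP v (eigenvector_limg tt Tv).
  rewrite Tv dotZl ler_pM2r ?(dot_gt0 d)//.
  by rewrite -sE ler_sqr ?nnegrE ?(ltW s0).
have smE : sigma_min d A = s.
  apply/le_anti/andP; split.
    by apply: ge_inf => //; exists s.
  by apply: lb_le_inf => //; exists s.
rewrite smE; split => // x xT.
rewrite -ler_sqr ?nnegrE ?mulr_ge0 ?dotnorm_ge0 ?(ltW s0)//.
by rewrite exprMn sE !sqr_dotnorm -dot_gram; exact: lP.
Qed.

End SmallestSingularValue.

(** * Robust recovery *)

(** The angle condition enters only here.  A non-zero k in K makes an angle larger
than theta with h, while <k, h> = |k|^2, hence |k| < cos theta * |h|. *)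
Lemma dotnorm_le_orthogonal_part (R : realType) (V : vectType R)
    (d : {dot V for idfun}) (theta : R) (C : set V) (K : {vspace V}) (h k r : V) :
  C h -> cone_expansion d theta C `&` [set` K] = [set 0] ->
  h = k + r -> k \in K -> d k r = 0 ->
  (1 - cos theta) * dotnorm d h <= 2 * dotnorm d r.
Proof.
move=> Ch CK hE kK kr.
have r0 := dotnorm_ge0 d r.
have [k0|k0] := eqVneq k 0.
  by rewrite hE k0 add0r ler_wpM2r//; have := cos_geN1 theta; lra.
have [h0|h0] := eqVneq h 0; first by rewrite h0 dotnorm0; lra.
have kh : d k h = dotnorm d k ^+ 2 by rewrite hE dotDr kr addr0 sqr_dotnorm.
have klt : dotnorm d k < cos theta * dotnorm d h.
  rewrite ltNge; apply: contraNN k0 => kge; apply/eqP.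
  have : (cone_expansion d theta C `&` [set` K]) k.
    split => //; right; exists h; split => //.
    by rewrite kh expr2 mulrAC ler_wpM2r ?dotnorm_ge0.
  by rewrite CK.
have := dotnormD d k r; rewrite -hE; lra.
Qed.

Theorem proposition7 (R : realType) :
  exists kappa : R -> R -> R,
    forall (V : vectType R) (d : {dot V for idfun}) (x0 : V)
      (m : nat) (A : 'Hom(V, 'cV[R]_m)) (f : V -> R) (theta : R),
      @convex_function R V setT f ->
      0 < theta <= pi ->
      cone_expansion d theta (descent_cone f x0) `&` [set` lker A] = [set 0] ->
      0 < kappa theta (sigma_min d A) /\
      forall (eps : R) (n b : 'cV[R]_m) (xhat : V),
        0 <= eps ->
        b = A x0 + n ->
        dotnorm (euclidean R m) n <= eps ->
        is_minimizer f (feasible A b eps) xhat ->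
        dotnorm d (xhat - x0) <= kappa theta (sigma_min d A) * eps.
Proof.
exists (fun theta s => if 0 < s then 4 / ((1 - cos theta) * s) else 1).
move=> V d x0 m A f theta _ /andP[theta0 thetapi] cone_ker.
have cos1 : 0 < 1 - cos theta.
  rewrite subr_gt0 -(cos0 R) ltr_cos// in_itv /= ?lexx ?pi_ge0//.
  by rewrite (ltW theta0).
split; first by case: ifP => // s0; rewrite divr_gt0// mulr_gt0.
move=> eps n b xhat eps0 bE nle [xfeas xmin].
set h := xhat - x0; pose T := (adjoint d (euclidean R m) A \o A)%VF.
have hD : descent_cone f x0 h.
  exists 1; split => //; rewrite scale1r addrC subrK; apply: xmin.
  by rewrite /feasible /= bE opprD addrA subrr add0r /dotnorm linearNl linearNr opprK.
have [r rT hr] := limg_lker_split (gram_symmetric d A) h.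
have kr : d (h - r) r = 0.
  by rewrite dotC (orthogonal_limg_lker (gram_symmetric d A) rT hr).
rewrite lker_gram in hr.
have hle := dotnorm_le_orthogonal_part hD cone_ker (esym (subrK r h)) hr kr.
have Ah : dotnorm (euclidean R m) (A r) <= 2 * eps.
  have -> : A r = (A xhat - b) + n.
    move: hr; rewrite memv_ker linearB subr_eq0 => /eqP <-.
    by rewrite linearB /= bE opprD addrA subrK.
  by apply: le_trans (dotnormD _ _ _) _; rewrite mulr_natl mulr2n lerD.
have [Tz|/sigma_min_bound[s0 sP]] := eqVneq (limg T) 0%VS.
  have r0 : r = 0 by apply/eqP; rewrite -memv0 -Tz.
  have h0 : dotnorm d h <= 0.
    by rewrite -(pmulr_rle0 _ cos1) (le_trans hle)// r0 dotnorm0 mulr0.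
  apply: (le_trans h0); rewrite mulr_ge0//; case: ifP => // s0.
  by rewrite ltW// divr_gt0// mulr_gt0.
rewrite s0 mulrAC ler_pdivlMr ?mulr_gt0// mulrA.
have := sP r rT; set s := sigma_min d A in s0 *.
rewrite [_ * (1 - _)]mulrC; nra.
Qed.
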